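(* Let $T$ be a locally finite biregular tree. Then any two uniform lattices of $T$ are commensurable in $\mathrm{Aut}(T)$: for any uniform lattices $\Gamma,\Gamma'\subset\mathrm{Aut}(T)$ there is $g\in\mathrm{Aut}(T)$ such that $g\Gamma g^{-1}\cap\Gamma'$ has finite index in both $g\Gamma g^{-1}$ and $\Gamma'$.
   Context: A locally finite biregular tree is a tree for which there are finite integers $p,q\ge1$ and a 2-colouring of the vertices (adjacent vertices having different colours) such that all vertices of the first colour have valency $p$ and all vertices of the second colour have valency $q$. A uniform lattice of $T$ is a subgroup of $\mathrm{Aut}(T)$ with finite vertex stabilizers and finitely many orbits of vertices. *)

(* Defs.v *)
From HB Require Import structures.
From mathcomp Require Import all_boot.
From mathcomp Require Import all_classical.

Set Implicit Arguments.
Unset Strict Implicit.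
Unset Printing Implicit Defensive.

Local Open Scope classical_set_scope.
Local Open Scope card_scope.
Local Open Scope group_scope.

(* Every type carries a choiceType structure classically, so taking the
   vertices in a choiceType is no restriction. *)
Record graph := Graph {
  vertex :> choiceType;
  adj : rel vertex;
  adj_sym : symmetric adj;
  adj_irr : irreflexive adj
}.

Definition neighbours (T : graph) (v : T) : set T := [set w | adj v w].

Definition connected_graph (T : graph) : Prop :=
  inhabited T /\
  forall x y : T, exists p : seq T, path (@adj T) x p /\ last x p = y.

(* [ucycle] also accepts the empty sequence and [:: x; y] with x, y adjacent,
   which are not cycles of the graph. *)
Definition acyclic_graph (T : graph) : Prop :=
  forall c : seq T, ucycle (@adj T) c -> size c <= 2.

Definition is_tree (T : graph) : Prop := connected_graph T /\ acyclic_graph T.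

Definition biregular (T : graph) (p q : nat) : Prop :=
  exists c : T -> bool,
    (forall x y : T, adj x y -> c x != c y) /\
    (forall x : T, neighbours x #= `I_(if c x then p else q)).

Definition locally_finite_biregular_tree (T : graph) : Prop :=
  is_tree T /\ exists p q : nat, [/\ 1 <= p, 1 <= q & biregular T p q].

Section Automorphisms.
Variable T : graph.

(* Automorphisms may exchange the two colours and may invert edges. *)
Record aut := Aut {
  aut_fun :> T -> T;
  aut_bij : bijective aut_fun;
  aut_adj : forall x y : T, adj (aut_fun x) (aut_fun y) = adj x y
}.

Lemma aut_ext (f g : aut) : f =1 g -> f = g.
Proof.
case: f g => [f fb fa] [g gb ga] /= /funext fg; move: fb fa; rewrite {}fg.
by move=> fb fa; congr Aut; exact: Prop_irrelevance.
Qed.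

HB.instance Definition _ := gen_eqMixin aut.
HB.instance Definition _ := gen_choiceMixin aut.

Definition aut_one : aut := @Aut id (Bijective (frefl id) (frefl id))
  (fun _ _ => erefl).

Fact aut_mul_adj (f g : aut) (x y : T) :
  adj ((f \o g) x) ((f \o g) y) = adj x y.
Proof. by rewrite /= !aut_adj. Qed.

(* (f * g) x = f (g x), unlike the convention used for permutations. *)
Definition aut_mul (f g : aut) : aut :=
  Aut (bij_comp (aut_bij f) (aut_bij g)) (aut_mul_adj f g).

Fact aut_has_inv (f : aut) : exists g : T -> T, cancel f g /\ cancel g f.
Proof. by case: (aut_bij f) => g fK gK; exists g. Qed.

Definition aut_inv_fun (f : aut) : T -> T := projT1 (cid (aut_has_inv f)).

Fact aut_funK (f : aut) : cancel f (aut_inv_fun f).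
Proof. exact: (projT2 (cid (aut_has_inv f))).1. Qed.

Fact aut_invK (f : aut) : cancel (aut_inv_fun f) f.
Proof. exact: (projT2 (cid (aut_has_inv f))).2. Qed.

Fact aut_inv_adj (f : aut) (x y : T) :
  adj (aut_inv_fun f x) (aut_inv_fun f y) = adj x y.
Proof. by rewrite -(aut_adj f) !aut_invK. Qed.

Definition aut_inv (f : aut) : aut :=
  Aut (Bijective (aut_invK f) (aut_funK f)) (aut_inv_adj f).

Fact aut_mulA : associative aut_mul.
Proof. by move=> f g h; exact: aut_ext. Qed.

Fact aut_mul1g : left_id aut_one aut_mul.
Proof. by move=> f; exact: aut_ext. Qed.

Fact aut_mulg1 : right_id aut_one aut_mul.
Proof. by move=> f; exact: aut_ext. Qed.

Fact aut_mulVg : left_inverse aut_one aut_inv aut_mul.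
Proof. by move=> f; apply: aut_ext => x; exact: aut_funK. Qed.

Fact aut_mulgV : right_inverse aut_one aut_inv aut_mul.
Proof. by move=> f; apply: aut_ext => x; exact: aut_invK. Qed.

HB.instance Definition _ :=
  isGroup.Build aut aut_mulA aut_mul1g aut_mulg1 aut_mulVg aut_mulgV.

End Automorphisms.

Definition subgroup (G : groupType) (H : set G) : Prop := group_closed [in H].

Definition left_coset (G : groupType) (x : G) (H : set G) : set G :=
  [set x * h | h in H].

Definition conjugate (G : groupType) (g : G) (H : set G) : set G :=
  [set g * h * g^-1 | h in H].

(* Meaningful when H is a subgroup of K. *)
Definition finite_index (G : groupType) (H K : set G) : Prop :=
  finite_set [set left_coset x H | x in K].

Definition vertex_stabilizer (T : graph) (Gamma : set (aut T)) (v : T) :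
  set (aut T) := [set f | Gamma f /\ f v = v].

Definition vertex_orbit (T : graph) (Gamma : set (aut T)) (v : T) : set T :=
  [set (f : aut T) v | f in Gamma].

Definition uniform_lattice (T : graph) (Gamma : set (aut T)) : Prop :=
  [/\ subgroup Gamma,
      forall v : T, finite_set (vertex_stabilizer Gamma v) &
      finite_set [set vertex_orbit Gamma v | v in [set: T]]].

(* Main.v *)
(* Work in the colour-preserving subgroup of each lattice.  If each lattice has
   a cocompact subset preserving a port numbering, that is, a numbering of the
   neighbours of each vertex, then Leighton's argument becomes canonical: glue a
   copy of the tree to another one by pairs [(v, v')] of vertices of the same
   colour together with a reflection [i |-> k - i] of ports modulo the valency.
   These states form a graph covering the tree by both projections, and as the
   tree is simply connected a component of it is the graph of an automorphism
   [g].  There are finitely many states modulo both groups, so the group of pairs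
   [(f, f')] with [f' g = g f] is cocompact, hence of finite index.

   The port numbering comes from a finite covering as well.  A frame at [v] is an
   element of the group carrying the representative of the orbit of [v] to [v];
   repeating frames so that each vertex carries the same number [N] of them, the
   frames at the two ends of an edge are free sets of equal size under the
   stabilizer of the edge, so they can be matched equivariantly.  A section of the
   resulting covering transports fixed port numberings at the orbit
   representatives to all of the tree. *)
Require Import Defs.
From mathcomp Require Import all_boot finmap.
From mathcomp Require Import all_classical.

Set Implicit Arguments.
Unset Strict Implicit.
Unset Printing Implicit Defensive.

Local Open Scope classical_set_scope.
Local Open Scope card_scope.

(** * Coverings of a tree *)

Section ColouredTree.
Variables (T : graph) (c : T -> bool).
Hypothesis connT : connected_graph T.
Hypothesis acycT : acyclic_graph T.
Hypothesis adj_c : forall x y : T, adj x y -> c x != c y.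

Lemma connected_ind (P : T -> Prop) (x0 : T) :
  P x0 -> (forall x y, adj x y -> P x -> P y) -> forall x, P x.
Proof.
move=> Px0 Padj x; have [p [pP <-]] := connT.2 x0 x.
elim: p x0 Px0 pP => //= y p IHp x0 Px0 /andP[x0y yp].
exact: IHp (Padj _ _ x0y Px0) yp.
Qed.

(** * Distances from a root and uniqueness of parents *)

Section Rooted.
Variable root : T.

(** The distance is the least length of a path from [root]; dropping the last vertex of a shortest
    path gives the predecessor. *)
Lemma distance_exists : exists d : T -> nat,
  [/\ forall x, d x = 0 -> x = root, d root = 0,
      forall x y, adj x y -> d y <= (d x).+1 &
      forall x, 0 < d x -> exists y, adj y x /\ d x = (d y).+1].
Proof.
pose P x n := `[< exists p, [/\ path (@adj T) root p, last root p = x & size p = n] >].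
have exP x : exists n, P x n.
  by have [p [pP px]] := connT.2 root x; exists (size p); apply/asboolP; exists p.
pose d x := ex_minn (exP x).
have dP x : exists p, [/\ path (@adj T) root p, last root p = x & size p = d x].
  by rewrite /d; case: ex_minnP => n /asboolP.
have d_le x n : P x n -> d x <= n by rewrite /d; case: ex_minnP => m _; apply.
have d_adj x y : adj x y -> d y <= (d x).+1.
  move=> xy; have [p [pP px ps]] := dP x; apply: d_le; apply/asboolP.
  by exists (rcons p y); rewrite rcons_path pP px last_rcons size_rcons ps.
exists d; split=> //.
- move=> x dx; have [p [_ px ps]] := dP x.
  by move: px; rewrite dx in ps; rewrite (size0nil ps).
- apply/eqP; rewrite -leqn0; apply: d_le; apply/asboolP.
  by exists [::].
- move=> x; have [p [pP px ps]] := dP x; rewrite -{1}ps.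
  case/lastP: p => // p y in pP px ps *.
  move: pP px; rewrite rcons_path last_rcons => /andP[pP py] yx _.
  exists (last root p); rewrite -yx; split=> //.
  apply/eqP; rewrite eqn_leq d_adj //= yx -ps size_rcons ltnS.
  by rewrite d_le //; apply/asboolP; exists p.
Qed.

(** Shorten the path to one without repetition and close it up through [v]: acyclicity bounds the
    length of the resulting cycle by 2, so the path is trivial. *)
Lemma no_bypass (v u w : T) (p : seq T) :
  adj v u -> adj v w -> path (@adj T) u p -> last u p = w -> v \notin u :: p ->
  u = w.
Proof.
move=> vu vw up pw vp; move: pw vp; case: (shortenP up) => q uq qU qp qw vp.
have vq : v \notin u :: q.
  apply: contra vp; rewrite !inE => /orP[->//|/qp->]; exact: orbT.
suff : size [:: v, u & q] <= 2 by case: q qw {uq qU qp vq} => //=.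
apply: acycT; apply/andP; split; last by rewrite cons_uniq vq.
by rewrite /= vu rcons_path uq qw adj_sym.
Qed.

Section Parents.
Variable d : T -> nat.
Hypothesis d0 : forall x, d x = 0 -> x = root.
Hypothesis droot : d root = 0.
Hypothesis d_adj : forall x y, adj x y -> d y <= (d x).+1.
Hypothesis d_pred : forall x, 0 < d x -> exists y, adj y x /\ d x = (d y).+1.

(** Descend one level from both ends and join there by induction. The bound keeps the path away from
    a common child of [u] and [w]. *)
Lemma low_path (n : nat) (u w : T) : d u = n -> d w = n ->
  exists p, [/\ path (@adj T) u p, last u p = w & all (fun x => d x <= n) p].
Proof.
elim: n u w => [|n IHn] u w du dw.
  by exists [::]; rewrite (d0 du) (d0 dw).
have [|u' [u'u du']] := @d_pred u; first by rewrite du.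
have [|w' [w'w dw']] := @d_pred w; first by rewrite dw.
have [||p [u'p pw' dp]] := IHn u' w'.
- by apply/eqP; rewrite -eqSS -du' du.
- by apply/eqP; rewrite -eqSS -dw' dw.
exists (u' :: rcons p w); rewrite /= rcons_path last_rcons adj_sym u'u u'p pw' w'w.
split=> //; rewrite all_rcons dw leqnn ltnW -?du' ?du //=.
by apply: sub_all dp => x /leqW.
Qed.

Lemma parent_unique (v u w : T) : adj u v -> adj w v ->
  d v = (d u).+1 -> d v = (d w).+1 -> u = w.
Proof.
move=> uv wv dvu dvw.
have [|p [up pw dp]] := @low_path (d u) u w erefl.
  by apply/eqP; rewrite -eqSS -dvu dvw.
apply: (@no_bypass v u w p); rewrite // 1?adj_sym //.
rewrite inE negb_or; apply/andP; split.
  by apply: contraTneq uv => ->; rewrite adj_irr.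
by apply/negP => /(allP dp); rewrite dvu ltnn.
Qed.

Lemma distance_parity (x : T) : c x = c root (+) odd (d x).
Proof.
move dx : (d x) => n; elim: n x dx => [|n IHn] x dx; first by rewrite (d0 dx) addbF.
have [|y [yx dy]] := @d_pred x; first by rewrite dx.
have := adj_c yx; rewrite (IHn y); last by apply/eqP; rewrite -eqSS -dy dx.
by rewrite /= addbN; case: (c x); case: (_ (+) _).
Qed.

(** Distances across an edge differ by at most 1, and equal distances would give equal colours. *)
Lemma adj_distance (x y : T) : adj x y -> d y = (d x).+1 \/ d x = (d y).+1.
Proof.
move=> xy; have := adj_c xy; rewrite (distance_parity x) (distance_parity y).
have := d_adj xy; have := d_adj (y := x) (x := y); rewrite adj_sym => /(_ xy).
rewrite leq_eqVlt => /orP[/eqP->|]; first by right.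
rewrite ltnS => xley; rewrite leq_eqVlt => /orP[/eqP->|]; first by left.
by rewrite ltnS => ylex; rewrite (@anti_leq (d x) (d y)) ?xley // eqxx.
Qed.

End Parents.
End Rooted.

(* [R] makes the states a graph and [pi] a covering of the tree by it; as the
   tree is simply connected the covering has a section. *)
Lemma covering_section (S : Type) (ok : S -> Prop) (R : S -> S -> Prop)
    (pi : S -> T) (s0 : S) :
  (forall s t, R s t -> R t s) ->
  (forall s w, ok s -> adj (pi s) w -> exists t, [/\ R s t, pi t = w & ok t]) ->
  ok s0 ->
  exists sec : T -> S,
    [/\ sec (pi s0) = s0, forall v, pi (sec v) = v, forall v, ok (sec v) &
        forall v w, adj v w -> R (sec v) (sec w)].
Proof.
move=> Rsym Rex ok0.
have [d [d0 droot d_adj d_pred]] := distance_exists (pi s0).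
have /choice[par parP] : forall x, exists y, 0 < d x -> adj y x /\ d x = (d y).+1.
  move=> x; have [/d_pred[y yP]|] := boolP (0 < d x); last by exists x.
  by exists y.
have /choice[nxt nxtP] : forall z : S * T, exists t, ok z.1 -> adj (pi z.1) z.2 ->
    [/\ R z.1 t, pi t = z.2 & ok t].
  move=> -[s w] /=; have [oks|] := pselect (ok s); last by exists s0.
  have [sw|] := boolP (adj (pi s) w); last by exists s0.
  by have [t tP] := Rex _ _ oks sw; exists t.
(* The lift of [x] follows the chosen parents, with the distance of [x] as recursion counter. *)
pose F := fix F (n : nat) (x : T) := if n is m.+1 then nxt (F m (par x), x) else s0.
have FP n x : d x = n -> pi (F n x) = x /\ ok (F n x).
  elim: n x => [|n IHn] x dx; first by rewrite (d0 _ dx).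
  have [|px dpx] := parP x; first by rewrite dx.
  have [|pF okF] := IHn (par x); first by apply/eqP; rewrite -eqSS -dpx dx.
  by have [|//] := nxtP (F n (par x), x) okF; rewrite /= ?pF.
have step v w : adj v w -> d w = (d v).+1 -> R (F (d v) v) (F (d w) w).
  move=> vw dw; have [|pw dpw] := parP w; first by rewrite dw.
  (* Uniqueness of parents identifies [v] with [par w], so this is the edge along which [w] was
     lifted. *)
  have -> : F (d w) w = nxt (F (d v) v, w).
    by rewrite dw /= (@parent_unique (pi s0) d d0 d_pred _ _ _ pw vw dpw dw).
  have [pF okF] := FP _ v erefl.
  by have [|//] := nxtP (F (d v) v, w) okF; rewrite /= ?pF.
exists (fun x => F (d x) x); split.
- by rewrite droot.
- by move=> v; have [] := FP _ v erefl.
- by move=> v; have [] := FP _ v erefl.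
move=> v w vw; have [dw|dv] := adj_distance d0 d_adj d_pred vw; first exact: step.
by apply: Rsym; apply: step; rewrite // adj_sym.
Qed.

End ColouredTree.

(** Local injectivity of [pi] carries agreement of the two lifts across each edge. *)
Lemma covering_unique (T : graph) (S : Type) (R : S -> S -> Prop) (pi : S -> T)
    (f g : T -> S) (x0 : T) :
  connected_graph T ->
  (forall s t t', R s t -> R s t' -> pi t = pi t' -> t = t') ->
  (forall v w, adj v w -> R (f v) (f w)) ->
  (forall v w, adj v w -> R (g v) (g w)) ->
  (forall v, pi (f v) = pi (g v)) -> f x0 = g x0 -> f =1 g.
Proof.
move=> connT Rinj fR gR fg fg0; apply: (connected_ind connT fg0) => x y xy fgx.
by apply: (Rinj (f x)); rewrite ?fg //; [exact: fR | rewrite fgx; exact: gR].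
Qed.

(** * Equivariant bijections of free finite sets *)

Lemma card_eqD (X : choiceType) (A B : set X) (n m : nat) :
  A #= `I_n -> B #= `I_m -> B `<=` A -> A `\` B #= `I_(n - m).
Proof.
move=> An Bm BA.
have fA : finite_set A by apply/finite_setP; exists n.
have fB : finite_set B by apply/finite_setP; exists m.
have /finite_setP[k ABk] : finite_set (A `\` B) by exact: finite_setD.
suff -> : n - m = k by [].
rewrite -(card_fset_set ABk) -(card_fset_set An) -(card_fset_set Bm).
rewrite fset_setD // cardfsD; congr (_ - #|` _|)%N; apply/esym/fsetIidPr.
by rewrite -fset_set_sub.
Qed.

Section FreeAction.
Variables (G : groupType) (F : set G) (X : choiceType) (act : G -> X -> X).
Hypothesis F1 : F 1%g.
Hypothesis FM : forall f g, F f -> F g -> F (f * g)%g.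
Hypothesis FV : forall f, F f -> F f^-1%g.
Hypothesis finF : finite_set F.
Hypothesis act1 : forall x, act 1%g x = x.
Hypothesis actM : forall f g x, act (f * g)%g x = act f (act g x).
Hypothesis act_free : forall f x, F f -> act f x = x -> f = 1%g.

Lemma act_inj (f g : G) (x : X) : F f -> F g -> act f x = act g x -> f = g.
Proof.
move=> Ff Fg fg; apply: (mulgI g^-1%g); rewrite mulVg.
apply: (@act_free _ x); first by apply: FM => //; exact: FV.
by rewrite actM fg -actM mulVg act1.
Qed.

(** Split off the orbits of a point [a] of [A] and a point [b] of [B]; by freeness both have as many
    elements as [F]. On them [act f a] goes to [act f b], and induction handles the smaller
    invariant remainders. *)
Lemma free_bijection (n : nat) (A B : set X) :
  A #= `I_n -> B #= `I_n ->
  (forall f x, F f -> A x -> A (act f x)) ->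
  (forall f x, F f -> B x -> B (act f x)) ->
  exists phi, set_bij A B phi /\
    forall f x, F f -> A x -> phi (act f x) = act f (phi x).
Proof.
have /finite_setP[m Fm] := finF.
elim/ltn_ind: n A B => n IHn A B An Bn AF BF.
case: n => [|n] in IHn An Bn *.
  move: An Bn; rewrite II0 !card_eq0 => /eqP A0 /eqP B0.
  by exists id; rewrite A0 B0; split=> //; split=> // x.
have /eq_cardSP[a Aa _] := An; have /eq_cardSP[b Bb _] := Bn.
pose orb x := [set act f x | f in F].
have orbm x : orb x #= `I_m.
  apply: card_eq_trans Fm; apply: inj_card_eq => f g.
  by rewrite !inE => Ff Fg; exact: act_inj.
have orbF x f y : F f -> orb x (act f y) <-> orb x y.
  move=> Ff; split=> -[g Fg gx]; last first.
    by exists (f * g)%g; [exact: FM | rewrite actM gx].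
  exists (f^-1 * g)%g; first by apply: FM => //; exact: FV.
  by rewrite actM gx -actM mulVg act1.
have m_gt0 : 0 < m.
  rewrite lt0n; apply: contraTneq Fm => ->; rewrite II0 card_eq0.
  by apply/eqP => F0; move: F1; rewrite F0.
have orbA : orb a `<=` A by move=> _ [f Ff <-]; exact: AF.
have orbB : orb b `<=` B by move=> _ [f Ff <-]; exact: BF.
have [|||||phi [[phiAB phi_inj phi_surj] phiF]] :=
    IHn (n.+1 - m) _ (A `\` orb a) (B `\` orb b).
- by rewrite ltn_subrL m_gt0.
- exact: card_eqD.
- exact: card_eqD.
- by move=> f x Ff [Ax xa]; split; [exact: AF | move/(orbF _ _ _ Ff)].
- by move=> f x Ff [Bx xb]; split; [exact: BF | move/(orbF _ _ _ Ff)].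
(* Freeness makes [t x] the only element of [F] carrying [a] to [x]; off the orbit its value is
   arbitrary. *)
have /choice[t tP] : forall x, exists f, orb a x -> F f /\ act f a = x.
  move=> x; have [[f Ff fa]|] := pselect (orb a x); last by exists 1%g.
  by exists f.
pose psi x := if `[< orb a x >] then act (t x) b else phi x.
have psiO x : orb a x -> psi x = act (t x) b.
  by move=> xa; rewrite /psi asboolT.
have psiC x : ~ orb a x -> psi x = phi x.
  by move=> xa; rewrite /psi asboolF.
have psi_orb x : A x -> orb b (psi x) -> orb a x.
  move=> Ax; have [//|xa] := pselect (orb a x).
  by rewrite psiC // => xb; have [] := phiAB x (conj Ax xa).
exists psi; split; first split.
- move=> x Ax /=; have [xa|xa] := pselect (orb a x).
    by rewrite psiO //; apply: BF => //; exact: (tP _ xa).1.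
  by rewrite psiC //; have [] := phiAB x (conj Ax xa).
- move=> x y; rewrite !inE => Ax Ay.
  have [xa|xa] := pselect (orb a x); have [ya|ya] := pselect (orb a y).
  + rewrite !psiO // => txy; have [Fx <-] := tP _ xa; have [Fy <-] := tP _ ya.
    by rewrite (act_inj Fx Fy txy).
  + move=> xy; case: ya; apply: psi_orb => //; rewrite -xy psiO //.
    by exists (t x) => //; exact: (tP _ xa).1.
  + move=> xy; case: xa; apply: psi_orb => //; rewrite xy psiO //.
    by exists (t y) => //; exact: (tP _ ya).1.
  + by rewrite !psiC //; apply: phi_inj; rewrite inE.
- move=> y By; have [[f Ff <-]|yb] := pselect (orb b y).
    have fa : orb a (act f a) by exists f.
    exists (act f a); first exact: orbA.
    have [Ft tfa] := tP _ fa.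
    by rewrite psiO // (act_inj Ft Ff tfa).
  have [x [Ax xa] <-] := phi_surj y (conj By yb).
  by exists x => //; rewrite psiC.
move=> f x Ff Ax; have [xa|xa] := pselect (orb a x); last first.
  by rewrite !psiC ?phiF // => /(orbF _ _ _ Ff).
have fxa : orb a (act f x) by exact/orbF.
rewrite !psiO // -actM; congr (act _ b).
have [Ft tx] := tP _ xa; have [Ft' tfx] := tP _ fxa.
by apply: (@act_inj _ _ a) => //; [exact: FM | rewrite actM tx].
Qed.
End FreeAction.

(** * Port numberings invariant under a lattice *)

Lemma card_eqX (X : Type) (A : set X) (n k : nat) :
  A #= `I_n -> A `*` `I_k #= `I_(n * k).
Proof.
move=> /card_set_bijP[phi [phi_fun phi_inj phi_surj]].
rewrite card_eq_sym.
pose g (z : X * nat) := phi z.1 * k + z.2.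
suff <- : g @` (A `*` `I_k) = `I_(n * k).
  apply: inj_card_eq => -[x i] [y j]; rewrite !inE /= => -[/= Ax ik] [/= Ay jk].
  have k0 : 0 < k by exact: leq_ltn_trans ik.
  rewrite /g /= => gxy; congr (_, _).
    apply: phi_inj; rewrite ?inE //.
    by have := congr1 (divn^~ k) gxy; rewrite !divnMDl // !divn_small // !addn0.
  by have := congr1 (modn^~ k) gxy; rewrite !modnMDl !modn_small.
apply/seteqP; split=> [_ [[x i] [/= Ax ik] <-]|j /= jnk].
  rewrite /g /=; apply: (@leq_trans ((phi x).+1 * k)).
    by rewrite mulSn addnC ltn_add2r.
  by rewrite leq_mul2r (phi_fun _ Ax) orbT.
have k0 : 0 < k by case: k jnk {g} => //; rewrite muln0.
have [|x Ax phix] := phi_surj (j %/ k); first by rewrite /= ltn_divLR.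
by exists (x, j %% k); [split=> //=; rewrite ltn_mod | rewrite /g /= phix -divn_eq].
Qed.

Lemma autM (T : graph) (f g : aut T) (x : T) : (f * g)%g x = f (g x).
Proof. by []. Qed.

Lemma autK (T : graph) (f : aut T) : cancel f (f^-1)%g.
Proof. exact: aut_funK. Qed.

Lemma autVK (T : graph) (f : aut T) : cancel (f^-1)%g f.
Proof. exact: aut_invK. Qed.

(** [l v w] is the port at [v] of the edge to [w]; it is unconstrained when [w] is not a neighbour
    of [v]. *)
Definition port_numbering (T : graph) (deg : T -> nat) (l : T -> T -> nat) : Prop :=
  forall v, set_bij (neighbours v) `I_(deg v) (l v).

Section Lattice.
Variables (T : graph) (c : T -> bool) (deg : T -> nat).
Hypothesis connT : connected_graph T.
Hypothesis acycT : acyclic_graph T.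
Hypothesis adj_c : forall x y : T, adj x y -> c x != c y.
Hypothesis degT : forall x : T, neighbours x #= `I_(deg x).

Variable G : set (aut T).
Hypothesis G1 : G 1%g.
Hypothesis GM : forall f g, G f -> G g -> G (f * g)%g.
Hypothesis GV : forall f, G f -> G f^-1%g.
Hypothesis Gc : forall f x, G f -> c (f x) = c x.
Hypothesis Gdeg : forall f x, G f -> deg (f x) = deg x.
Hypothesis Gfin : forall v, finite_set (vertex_stabilizer G v).

(** * Orbit representatives and frames *)

Definition orbit_rep (v : T) : T :=
  choose (fun w => `[< exists2 f, G f & f w = v >]) v.

Lemma orbit_repP (v : T) : exists2 f, G f & f (orbit_rep v) = v.
Proof.
have : `[< exists2 f, G f & f v = v >] by apply/asboolP; exists 1%g.
by move/(@chooseP _ (fun w => `[< exists2 f, G f & f w = v >]))/asboolP.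
Qed.

(** The result of [choose] depends only on the predicate once the default satisfies it, and the
    predicate depends only on the orbit. *)
Lemma orbit_rep_act (f : aut T) (v : T) : G f -> orbit_rep (f v) = orbit_rep v.
Proof.
move=> Gf; rewrite /orbit_rep.
have eqP : (fun w => `[< exists2 g : aut T, G g & g w = f v >]) =1
  (fun w => `[< exists2 g : aut T, G g & g w = v >]).
  move=> w; apply/asboolP/asboolP => -[g Gg gw].
    by exists (f^-1 * g)%g; [apply: GM => //; exact: GV | rewrite autM gw autK].
  by exists (f * g)%g; [exact: GM | rewrite autM gw].
rewrite (eq_choose eqP); apply: choose_id; apply/asboolP.
  by exists f^-1%g; [exact: GV | rewrite autK].
by exists 1%g.
Qed.

Definition frames (v : T) : set (aut T) :=
  [set f | G f /\ f (orbit_rep v) = v].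

Lemma frames_act (f g : aut T) (v : T) :
  G f -> frames v g -> frames (f v) (f * g)%g.
Proof.
by move=> Gf [Gg gv]; split; [exact: GM | rewrite orbit_rep_act // autM gv].
Qed.

(** The frames at [v] form a coset of the finite stabilizer of the representative, and left
    multiplication by [g] carries them to those at [g v]. *)
Lemma frames_card (v : T) : exists2 n, 0 < n & forall f, G f -> frames (f v) #= `I_n.
Proof.
have [f Gf fv] := orbit_repP v.
have /finite_setP[n An] : finite_set (frames v).
  have -> : frames v = [set (f * g)%g | g in vertex_stabilizer G (orbit_rep v)].
    apply/seteqP; split=> [g [Gg gv]|_ [g [Gg gv] <-]].
      exists (f^-1 * g)%g; last by rewrite mulVKg.
      by split; [apply: GM => //; exact: GV | rewrite autM gv -{1}fv autK].
    by split; [exact: GM | rewrite autM gv].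
  exact: finite_image.
exists n.
  rewrite lt0n; apply: contraTneq An => ->; rewrite II0 card_eq0; apply/eqP => A0.
  by have : frames v f by []; rewrite A0.
move=> g Gg; apply: card_eq_trans An.
have -> : frames (g v) = [set (g * h)%g | h in frames v].
  apply/seteqP; split=> [h hv|_ [h hv <-]]; last exact: frames_act.
  exists (g^-1 * h)%g; last by rewrite mulVKg.
  by rewrite -[v](autK g); apply: frames_act => //; exact: GV.
by apply: inj_card_eq => h1 h2 _ _ /mulgI.
Qed.

Variables (K : finType) (kappa : T -> K).
Hypothesis kappaP : forall v w, kappa v = kappa w -> exists2 f, G f & f v = w.

Lemma common_multiple : exists N : nat, forall v, exists n : nat,
  [/\ 0 < n, (n %| N)%N, 0 < N & frames v #= `I_n].
Proof.
have /choice[n nP] : forall v, exists n, 0 < n /\ forall f, G f -> frames (f v) #= `I_n.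
  by move=> v; have [n] := frames_card v; exists n.
have [[x0] _] := connT.
(* One vertex is picked for each value of [kappa]; values not attained get [x0], which keeps the
   product positive. *)
have /choice[x xP] : forall k : K, exists x, forall v, kappa v = k -> kappa x = k.
  move=> k; have [[v vk]|nk] := pselect (exists v, kappa v = k); first by exists v.
  by exists x0 => v vk; case: nk; exists v.
exists (\prod_(k : K) n (x k)) => v; exists (n (x (kappa v))); split.
- exact: (nP _).1.
- by rewrite (bigD1 (kappa v)) //= dvdn_mulr.
- by apply: prodn_gt0 => k; exact: (nP _).1.
have [f Gf fx] := kappaP (xP (kappa v) v erefl).
by rewrite -{1}fx; exact: (nP _).2.
Qed.

(** A triple is a vertex, a frame and the index of a copy of that frame; left multiplication on the
    frame makes the action free. *)
Definition frame_act (f : aut T) (d : T * aut T * nat) : T * aut T * nat :=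
  (f d.1.1, (f * d.1.2)%g, d.2).

Lemma frame_act1 d : frame_act 1%g d = d.
Proof. by case: d => -[v g] i; rewrite /frame_act mul1g. Qed.

Lemma frame_actM f g d : frame_act (f * g)%g d = frame_act f (frame_act g d).
Proof. by rewrite /frame_act /= mulgA. Qed.

Lemma frame_act_free f d : frame_act f d = d -> f = 1%g.
Proof.
by move/(congr1 (fun d' => d'.1.2)) => fg; apply: (mulIg d.1.2); rewrite mul1g.
Qed.

Lemma frame_actK f : cancel (frame_act f) (frame_act f^-1%g).
Proof. by move=> d; rewrite -frame_actM mulVg frame_act1. Qed.

Lemma frame_actVK f : cancel (frame_act f^-1%g) (frame_act f).
Proof. by move=> d; rewrite -frame_actM mulgV frame_act1. Qed.

(** * Equivariant matching of the fibres over pairs of vertices *)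

Section Fibres.
Variable fibre : T -> set (T * aut T * nat).
Variable N : nat.
Hypothesis fibre_card : forall v, fibre v #= `I_N.
Hypothesis fibre_act : forall f v d, G f -> fibre v d -> fibre (f v) (frame_act f d).

Definition edge_rep (e : T * T) : T * T :=
  choose (fun e' => `[< exists2 f : aut T, G f & (f e'.1, f e'.2) = e >]) e.

Lemma edge_repP e : exists2 f : aut T, G f & (f (edge_rep e).1, f (edge_rep e).2) = e.
Proof.
have : `[< exists2 f : aut T, G f & (f e.1, f e.2) = e >].
  by apply/asboolP; exists 1%g => //; case: e.
by move/(@chooseP _ (fun e' =>
  `[< exists2 f : aut T, G f & (f e'.1, f e'.2) = e >]))/asboolP.
Qed.

Lemma edge_rep_act (f : aut T) v w : G f -> edge_rep (f v, f w) = edge_rep (v, w).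
Proof.
move=> Gf; rewrite /edge_rep.
have eqP : (fun e' : T * T =>
      `[< exists2 g : aut T, G g & (g e'.1, g e'.2) = (f v, f w) >])
  =1 (fun e' => `[< exists2 g : aut T, G g & (g e'.1, g e'.2) = (v, w) >]).
  move=> -[x y] /=; apply/asboolP/asboolP => -[g Gg [gx gy]].
    by exists (f^-1 * g)%g; [apply: GM => //; exact: GV | rewrite !autM gx gy !autK].
  by exists (f * g)%g; [exact: GM | rewrite !autM gx gy].
rewrite (eq_choose eqP); apply: choose_id; apply/asboolP => /=.
  by exists f^-1%g; [exact: GV | rewrite !autK].
by exists 1%g.
Qed.

(** Over a representative pair the two fibres are free sets of equal size under the stabilizer of
    the pair, so they match equivariantly; the matching is then transported along the orbit of the
    pair. *)
Lemma edge_bijections : exists psi : T -> T -> T * aut T * nat -> T * aut T * nat,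
  (forall v w, set_bij (fibre v) (fibre w) (psi v w)) /\
  (forall f v w d, G f -> fibre v d ->
     psi (f v) (f w) (frame_act f d) = frame_act f (psi v w d)).
Proof.
have /choice[psi0 psi0P] : forall e : T * T,
    exists phi : T * aut T * nat -> T * aut T * nat,
    set_bij (fibre e.1) (fibre e.2) phi /\
    forall (f : aut T) d, [/\ G f, f e.1 = e.1 & f e.2 = e.2] -> fibre e.1 d ->
      phi (frame_act f d) = frame_act f (phi d).
  move=> [v w] /=.
  apply: (@free_bijection _ [set f : aut T | [/\ G f, f v = v & f w = w]] _ frame_act
    _ _ _ _ _ _ _ N) => //.
  - move=> f g [Gf fv fw] [Gg gv gw].
    by split; [exact: GM | rewrite autM gv | rewrite autM gw].
  - move=> f [Gf fv fw].
    by split; [exact: GV | rewrite -{1}fv autK | rewrite -{1}fw autK].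
  - by apply: sub_finite_set (Gfin v) => f [].
  - exact: frame_act1.
  - exact: frame_actM.
  - by move=> f d _; exact: frame_act_free.
  - by move=> f d [Gf fv fw] /(fibre_act Gf); rewrite fv.
  - by move=> f d [Gf fv fw] /(fibre_act Gf); rewrite fw.
have /choice[k kP] : forall e : T * T, exists f : aut T,
    G f /\ (f (edge_rep e).1, f (edge_rep e).2) = e.
  by move=> e; have [f] := edge_repP e; exists f.
pose psi v w d :=
  frame_act (k (v, w)) (psi0 (edge_rep (v, w)) (frame_act (k (v, w))^-1%g d)).
have k1 v w : k (v, w) (edge_rep (v, w)).1 = v by have [_ []] := kP (v, w).
have k2 v w : k (v, w) (edge_rep (v, w)).2 = w by have [_ []] := kP (v, w).
have kG v w : G (k (v, w)) by have [] := kP (v, w).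
have fibreV v w d : fibre v d -> fibre (edge_rep (v, w)).1 (frame_act (k (v, w))^-1%g d).
  move=> vd; rewrite -[(edge_rep _).1](autK (k (v, w))) k1.
  by apply: fibre_act => //; exact: GV.
exists psi; split.
  move=> v w; have [[p_fun p_inj p_surj] _] := psi0P (edge_rep (v, w)); split.
  - move=> d vd; rewrite /= -{1}(k2 v w).
    by apply: fibre_act => //; apply: p_fun; exact: fibreV.
  - move=> d d'; rewrite !inE => vd vd' /(can_inj (frame_actK _)) pdd'.
    apply: (can_inj (frame_actK (k (v, w))^-1%g)).
    by apply: p_inj; rewrite ?inE //; exact: fibreV.
  move=> d wd; have [|d' vd' pd'] := p_surj (frame_act (k (v, w))^-1%g d).
    by rewrite -[(edge_rep _).2](autK (k (v, w))) k2; apply: fibre_act => //; exact: GV.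
  exists (frame_act (k (v, w)) d'); first by rewrite -{1}(k1 v w); exact: fibre_act.
  by rewrite /psi frame_actK pd' frame_actVK.
move=> f v w d Gf vd; have [_ p_act] := psi0P (edge_rep (v, w)).
rewrite /psi edge_rep_act //.
(* The discrepancy [h] of the two transporters stabilizes the representative pair, so the matching
   commutes with it. *)
set h := ((k (f v, f w))^-1 * f * k (v, w))%g.
have -> : frame_act (k (f v, f w))^-1%g (frame_act f d) =
    frame_act h (frame_act (k (v, w))^-1%g d).
  by rewrite -!frame_actM mulgK.
rewrite p_act; last exact: fibreV.
  by rewrite -!frame_actM /h !mulgA mulgV mul1g.
split.
- by apply: GM => //; apply: GM => //; exact: GV.
- apply: (can_inj (autK (k (f v, f w)))).
  by rewrite !autM autVK k1 -(edge_rep_act v w Gf) k1.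
- apply: (can_inj (autK (k (f v, f w)))).
  by rewrite !autM autVK k2 -(edge_rep_act v w Gf) k2.
Qed.
End Fibres.

(** A section of the covering picks a frame at each vertex, and the frame carries over the ports of
    the representative. Automorphisms in [G] commuting with the section preserve the numbering. *)
Lemma invariant_port_numbering : exists (K' : finType) (kappa' : T -> K')
    (l : T -> T -> nat),
  port_numbering deg l /\
  forall v w, kappa' v = kappa' w -> exists f, [/\ G f, f v = w &
    forall x y, l (f x) (f y) = l x y].
Proof.
have [N NP] := common_multiple.
have /choice[n {}NP] := NP.
pose fibre v := [set d : T * aut T * nat |
  [/\ d.1.1 = v, frames v d.1.2 & d.2 < N %/ n v]].
have n_act f v : G f -> n (f v) = n v.
  move=> Gf; have [m _ mP] := frames_card v.
  have [_ _ _ nv] := NP v; have [_ _ _ nfv] := NP (f v).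
  have eqm a (A : set (aut T)) : A #= `I_a -> A #= `I_m -> a = m.
    by move=> Aa Am; apply/card_eq_II/(card_eq_trans _ Am); rewrite card_eq_sym.
  rewrite (eqm _ _ nfv (mP f Gf)) (eqm _ _ nv) //; exact: (mP 1%g G1).
have fibre_card v : fibre v #= `I_N.
  have [n_gt0 nN N_gt0 nv] := NP v.
  have := card_eqX (N %/ n v) nv; rewrite mulnC divnK //.
  apply: card_eq_trans.
  have -> : fibre v = (fun z : aut T * nat => (v, z.1, z.2)) @`
      (frames v `*` `I_(N %/ n v)).
    apply/seteqP; split=> [[[x g] i] [/= xv gv iN]|_ [[g i] [/= gv iN] <-]] //.
    by exists (g, i); rewrite //= xv.
  by apply: inj_card_eq => -[g i] [g' i'] _ _ [-> ->].
have fibre_act f v d : G f -> fibre v d -> fibre (f v) (frame_act f d).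
  move=> Gf [dv gv iN]; split; rewrite ?n_act //= ?dv //; exact: frames_act.
have [psi [psi_bij psi_act]] := edge_bijections fibre_card fibre_act.
pose S := (T * aut T * nat)%type.
pose pi (d : S) := d.1.1.
have fpi v d : fibre v d -> pi d = v by case.
(* [psi v w] and [psi w v] need not be mutually inverse, so each edge uses only the one starting at
   its end of colour [true]; this makes [R] symmetric. *)
pose R (d d' : S) := [/\ fibre (pi d) d, fibre (pi d') d', adj (pi d) (pi d') &
  if c (pi d) then d' = psi (pi d) (pi d') d else d = psi (pi d') (pi d) d'].
have Rsym d d' : R d d' -> R d' d.
  move=> [fd fd' dd' eqd]; split; rewrite // 1?adj_sym //.
  by move: (adj_c dd') eqd; case: (c (pi d)); case: (c (pi d')).
have Rex d w : fibre (pi d) d -> adj (pi d) w ->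
    exists d', [/\ R d d', pi d' = w & fibre (pi d') d'].
  move=> fd dw; case cd : (c (pi d)).
    have [p_fun _ _] := psi_bij (pi d) w.
    have fd' := p_fun _ fd; have pd' := fpi _ _ fd'.
    by exists (psi (pi d) w d); rewrite /R pd' cd; split.
  have [_ _ p_surj] := psi_bij w (pi d); have [d' fd' dd'] := p_surj _ fd.
  have pd' := fpi _ _ fd'.
  by exists d'; rewrite /R pd' cd; split.
have Rinj d d1 d2 : R d d1 -> R d d2 -> pi d1 = pi d2 -> d1 = d2.
  move=> [fd f1 _ e1] [_ f2 _ e2] e12; move: e1 e2; rewrite e12.
  case: (c (pi d)) => [-> <- //|e1 e2].
  have [_ p_inj _] := psi_bij (pi d2) (pi d).
  by apply: p_inj; [apply: mem_set; rewrite -e12 | exact: mem_set | rewrite -e1].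
have Ract f d d' : G f -> R d d' -> R (frame_act f d) (frame_act f d').
  move=> Gf [fd fd' dd' eqd]; split; try exact: fibre_act.
    by rewrite /pi /= aut_adj.
  rewrite /pi /= Gc //; move: eqd; rewrite /pi; case: (c d.1.1) => e.
    by rewrite psi_act // -e.
  by rewrite psi_act // -e.
have [[x0] _] := connT.
have [d0 fd0] : exists d, fibre x0 d.
  have [n_gt0 nN N_gt0 _] := NP x0; have [f Gf fx] := orbit_repP x0.
  by exists (x0, f, 0); split; rewrite //= divn_gt0 // dvdn_leq.
have pd0 := fpi _ _ fd0.
have [|sec [_ secP sec_ok secR]] :=
  @covering_section T c connT acycT adj_c S (fun d => fibre (pi d) d) R pi d0 Rsym Rex.
  by rewrite pd0.
have secF v : fibre v (sec v) by rewrite -{1}(secP v).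
have /choice[lam lamP] : forall r : T, exists f : T -> nat,
    set_bij (neighbours r) `I_(deg r) f.
  by move=> r; exact/card_set_bijP.
(* The class of [v] also records the copy index of its lift, which [frame_act] leaves fixed; the
   index is below [N.+1], so [inord] keeps it. *)
exists (K * 'I_N.+1)%type, (fun v => (kappa v, inord (sec v).2)),
  (fun v w => lam (orbit_rep v) ((sec v).1.2^-1%g w)).
split.
  move=> v; have [_ [Gg gr] _] := secF v; set g := (sec v).1.2 in Gg gr *.
  have degr : deg (orbit_rep v) = deg v by rewrite -{2}gr Gdeg.
  have [l_fun l_inj l_surj] := lamP (orbit_rep v).
  have nbV x : neighbours v x -> neighbours (orbit_rep v) (g^-1%g x).
    by rewrite /neighbours /= -{1}gr -{1}[x](autVK g) aut_adj.
  rewrite -degr; split.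
  - by move=> x /nbV /l_fun.
  - move=> x y; rewrite !inE => vx vy /l_inj; rewrite !inE => /(_ (nbV _ vx) (nbV _ vy)).
    by move/(can_inj (autVK g)).
  - move=> i /l_surj[x rx <-]; exists (g x); last by rewrite autK.
    by rewrite /neighbours /= -gr aut_adj.
move=> v w [/kappaP[f Gf fv] /(congr1 val)].
have sec_lt x : (sec x).2 < N.+1.
  by have [_ _ iN] := secF x; rewrite ltnS ltnW // (leq_trans iN) // leq_div.
rewrite /= !inordK // => eqi.
have [_ [Gv vr] _] := secF v; have [_ [Gw wr] _] := secF w.
have rvw : orbit_rep w = orbit_rep v by rewrite -fv orbit_rep_act.
set h := ((sec w).1.2 * (sec v).1.2^-1)%g.
have Gh : G h by apply: GM => //; exact: GV.
have hv : h v = w.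
  rewrite autM -[RHS]wr rvw; congr (_ _).
  by apply: (can_inj (autK (sec v).1.2)); rewrite autVK vr.
(* Both sides lie over [h x], and [h] was chosen to make them agree at [v]. *)
have hsec : (fun x => frame_act h (sec x)) =1 (fun x => sec (h x)).
  apply: (@covering_unique T S R pi _ _ v connT Rinj).
  - by move=> x y xy; exact/Ract/secR.
  - by move=> x y xy; apply: secR; rewrite aut_adj.
  - by move=> x; rewrite /pi /= -/(pi (sec x)) -/(pi (sec (h x))) !secP.
  have secE x : sec x = (x, (sec x).1.2, (sec x).2).
    by have := secP x; case: (sec x) => -[y g] i /= <-.
  by rewrite hv [RHS]secE -eqi /frame_act [(sec v).1.1]secP hv /h mulgVK.
exists h; split=> // x y.
rewrite -[sec (h x)]hsec orbit_rep_act //.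
rewrite (_ : (frame_act h (sec x)).1.2 = (h * (sec x).1.2)%g) //.
congr (lam _ _); apply: (can_inj (autK (h * (sec x).1.2)%g)).
by rewrite autVK autM autVK.
Qed.

End Lattice.

(** * Gluing two port numberings *)

Section Gluing.
Variables (T : graph) (c : T -> bool) (deg : T -> nat).
Hypothesis connT : connected_graph T.
Hypothesis acycT : acyclic_graph T.
Hypothesis adj_c : forall x y : T, adj x y -> c x != c y.
Hypothesis deg_gt0 : forall x, 0 < deg x.
Hypothesis deg_c : forall x y, c x = c y -> deg x = deg y.

(* A state [(v, v', k)] glues the neighbours of [v] to those of [v'] by the
   reflection [i |-> k - i] of their ports; given the edges above and below,
   exactly one reflection matches them, so each edge leads to a unique state. *)
Definition glue (l l' : T -> T -> nat) (s t : T * T * nat) : Prop :=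
  [/\ adj s.1.1 t.1.1, adj s.1.2 t.1.2, c s.1.1 = c s.1.2, c t.1.1 = c t.1.2 &
      s.2 = (l s.1.1 t.1.1 + l' s.1.2 t.1.2) %% deg s.1.1 /\
      t.2 = (l t.1.1 s.1.1 + l' t.1.2 s.1.2) %% deg t.1.1].

Definition swap (s : T * T * nat) : T * T * nat := (s.1.2, s.1.1, s.2).

Definition gluing_state (s : T * T * nat) : Prop :=
  c s.1.1 = c s.1.2 /\ s.2 < deg s.1.1.

Lemma gluing_state_swap s : gluing_state s -> gluing_state (swap s).
Proof. by move=> [cs ks]; split=> //=; rewrite -(deg_c cs). Qed.

Lemma glue_sym l l' s t : glue l l' s t -> glue l l' t s.
Proof. by move=> [? ? ? ? []]; split; rewrite // adj_sym. Qed.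

Lemma glue_swap l l' s t : glue l l' s t -> glue l' l (swap s) (swap t).
Proof.
move=> [st st' cs ct [es et]]; split=> //=.
by rewrite es et addnC (deg_c cs) [_ + l t.1.1 _]addnC (deg_c ct).
Qed.

Lemma glue_ex l l' s w : port_numbering deg l -> port_numbering deg l' ->
  gluing_state s -> adj s.1.1 w -> exists t, [/\ glue l l' s t, t.1.1 = w & gluing_state t].
Proof.
case: s => -[v v'] k lP lP' [/= cvv' kv] vw.
have [l_fun _ _] := lP v; have [_ _ l_surj'] := lP' v'.
have lvw : l v w < deg v := l_fun w vw.
(* The reflected port is [k - l v w] modulo the valency; adding [deg v] first avoids truncated
   subtraction. *)
have [|w' vw' lw'] := l_surj' ((k + deg v - l v w) %% deg v).
  by rewrite /= -(deg_c cvv') ltn_mod.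
have cww' : c w = c w'.
  move: (adj_c vw) (adj_c vw') cvv'.
  by case: (c v); case: (c v'); case: (c w); case: (c w').
exists (w, w', (l w v + l' w' v') %% deg w); split=> //; last first.
  by split=> //=; rewrite ltn_mod.
split=> //=; split=> //; rewrite lw' modnDmr subnKC; last first.
  by rewrite (leq_trans (ltnW lvw)) // leq_addl.
by rewrite modnDr modn_small.
Qed.

(** The reflection determines the port of the edge in the second copy modulo the valency, and ports
    are smaller than the valency. *)
Lemma glue_inj l l' s t t' : port_numbering deg l' ->
  glue l l' s t -> glue l l' s t' -> t.1.1 = t'.1.1 -> t = t'.
Proof.
case: s t t' => -[v v'] k [[w w'] m] [[x x'] n] lP' /=.
move=> [/= _ vw' cv cw [ek em]] [/= _ vx' _ _ [ek' en]] wx; subst x.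
have [l_fun l_inj _] := lP' v'.
suff wx' : w' = x' by rewrite em en wx'.
apply: l_inj; rewrite ?inE //; apply/eqP.
have dv : deg v = deg v' := deg_c cv.
rewrite -(modn_small (l_fun _ vw')) -(modn_small (l_fun _ vx')) -dv.
by rewrite -(eqn_modDl (l v w)) -ek -ek'.
Qed.

(** Sections of the two projections through one common state give [g] and its inverse. A pair
    [(f, f')] preserving colours and ports acts on states, so matching one state of the section with
    another makes it intertwine with [g] everywhere. *)
Lemma glued_automorphism (l l' : T -> T -> nat) :
  port_numbering deg l -> port_numbering deg l' ->
  exists (g : aut T) (k : T -> nat), (forall v, k v < deg v) /\
    forall (f f' : aut T) v w,
      (forall x, c (f x) = c x) -> (forall x, c (f' x) = c x) ->
      (forall x y, l (f x) (f y) = l x y) ->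
      (forall x y, l' (f' x) (f' y) = l' x y) ->
      f v = w -> f' (g v) = g w -> k v = k w -> forall x, f' (g x) = g (f x).
Proof.
move=> lP lP'; have [[x0] _] := connT.
pose R := glue l l'.
have R2ex s w : gluing_state s -> adj s.1.2 w -> exists t, [/\ R s t, t.1.2 = w & gluing_state t].
  move=> /gluing_state_swap oks sw; have [t [st tw okt]] := glue_ex lP' lP oks sw.
  exists (swap t); split=> //; last exact: gluing_state_swap.
  by have := glue_swap st; case: (s) => -[].
have R2inj s t t' : R s t -> R s t' -> t.1.2 = t'.1.2 -> t = t'.
  move=> /glue_swap st /glue_swap st' tt'.
  have := glue_inj lP st st' tt'.
  by case: (t) (t') => -[? ?] ? [[? ?] ?] [-> -> ->].
have R1inj s t t' : R s t -> R s t' -> t.1.1 = t'.1.1 -> t = t'.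
  exact: glue_inj.
have ok0 : gluing_state (x0, x0, 0) by split.
have Rsym s t : R s t -> R t s by exact: glue_sym.
have [sec [sec0 secP sec_ok secR]] :=
  covering_section connT acycT adj_c Rsym (fun s w => glue_ex lP lP') ok0.
have [sec2 [sec20 secP2 _ secR2]] :=
  covering_section connT acycT adj_c Rsym R2ex ok0.
move: sec0 sec20 => /= sec0 sec20.
pose g v := (sec v).1.2; pose h v := (sec2 v).1.1.
have g_adj v w : adj v w -> adj (g v) (g w) by move/secR => [].
have h_adj v w : adj v w -> adj (h v) (h w) by move/secR2 => [].
(* Both are lifts of [g] for the second projection through the base state. *)
have sec2g : (fun v => sec2 (g v)) =1 sec.
  apply: (@covering_unique T _ R (fun s => s.1.2) _ _ x0 connT R2inj) => //.
  - by move=> v w vw; exact/secR2/g_adj.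
  - by rewrite /g sec0 /= sec20.
have sech : (fun v => sec (h v)) =1 sec2.
  apply: (@covering_unique T _ R (fun s => s.1.1) _ _ x0 connT R1inj) => //.
  - by move=> v w vw; exact/secR/h_adj.
  - by rewrite /h sec20 /= sec0.
have gK : cancel g h by move=> v; rewrite /h [sec2 _]sec2g secP.
have hK : cancel h g by move=> v; rewrite /g [sec _]sech secP2.
have g_adjE x y : adj (g x) (g y) = adj x y.
  by apply/idP/idP => [/h_adj|/g_adj//]; rewrite !gK.
exists (Aut (Bijective gK hK) g_adjE), (fun v => (sec v).2); split=> /=.
  by move=> v; have [_] := sec_ok v; rewrite secP.
move=> f f' v w fc fc' fl fl' fv fgv kvw.
pose actS (s : T * T * nat) := (f s.1.1, f' s.1.2, s.2).
have secE y : sec y = (y, g y, (sec y).2).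
  by have := secP y; rewrite /g; case: (sec y) => -[? ?] ? /= ->.
suff E : (fun y => actS (sec y)) =1 (fun y => sec (f y)).
  by move=> x; have /(congr1 (fun s => s.1.2)) := E x.
apply: (@covering_unique T _ R (fun s => s.1.1) _ _ v connT R1inj).
- move=> y z /secR [yz yz' cy cz [ky kz]].
  have degf u : deg (f u) = deg u by exact: deg_c.
  by split; rewrite /= ?aut_adj ?fc ?fc' ?fl ?fl' ?degf.
- by move=> y z yz; apply: secR; rewrite aut_adj.
- by move=> y; rewrite /= !secP.
- by rewrite fv [RHS]secE /actS [(sec v).1.1]secP fv -/(g v) fgv kvw.
Qed.

End Gluing.

(** * Cosets *)

Section Subgroups.
Variables (G : groupType) (H : set G).
Hypothesis subH : subgroup H.

Lemma subgroup1 : H 1%g.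
Proof. by have [/set_mem] := subH. Qed.

Lemma subgroupV x : H x -> H x^-1%g.
Proof. by move=> /mem_set Hx; apply: set_mem; exact: group_closedV subH _ Hx. Qed.

Lemma subgroupM x y : H x -> H y -> H (x * y)%g.
Proof.
by move=> /mem_set Hx /mem_set Hy; apply: set_mem; exact: group_closedM subH _ _ Hx Hy.
Qed.

Lemma left_cosetM x y : H y -> left_coset (x * y)%g H = left_coset x H.
Proof.
move=> Hy; apply/seteqP; split=> _ [h Hh <-].
  by exists (y * h)%g; [exact: subgroupM | rewrite mulgA].
exists (y^-1 * h)%g; first by apply: subgroupM => //; exact: subgroupV.
by rewrite mulgA mulgK.
Qed.

End Subgroups.

Lemma subgroup_intro (G : groupType) (H : set G) : H 1%g ->
  (forall x y, H x -> H y -> H (x * y^-1)%g) -> subgroup H.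
Proof.
move=> H1 HD; split; first exact: mem_set.
by move=> x y /set_mem Hx /set_mem Hy; apply: mem_set; exact: HD.
Qed.

Lemma subgroupI (G : groupType) (H H' : set G) :
  subgroup H -> subgroup H' -> subgroup (H `&` H').
Proof.
move=> sH sH'; apply: subgroup_intro; first by split; exact: subgroup1.
move=> x y [Hx Hx'] [Hy Hy'].
by split; apply: subgroupM => //; exact: subgroupV.
Qed.

Lemma subgroup_conjugate (G : groupType) (g : G) (H : set G) :
  subgroup H -> subgroup (conjugate g H).
Proof.
move=> sH; apply: subgroup_intro.
  by exists 1%g; [exact: subgroup1 | rewrite mulg1 mulgV].
move=> _ _ [x Hx <-] [y Hy <-]; exists (x * y^-1)%g.
  by apply: subgroupM => //; exact: subgroupV.
by rewrite !invgM invgK !mulgA mulgVK.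
Qed.

(** Some [h] in [H] moves [x^-1 v0] to [y^-1 v0] for one of finitely many [y]. Then
    [s = x h^-1 y^-1] fixes [v0], and [x H = s y H] leaves finitely many cosets. *)
Lemma finite_index_cocompact (T : graph) (G H : set (aut T)) (v0 : T)
    (K : finType) (kappa : T -> K) :
  subgroup G -> subgroup H -> H `<=` G ->
  finite_set (vertex_stabilizer G v0) ->
  (forall v w, kappa v = kappa w -> exists2 f, H f & f v = w) ->
  finite_index H G.
Proof.
move=> sG sH HG Gfin kappaP.
have /choice[r rP] : forall k : K, exists y : aut T, forall x : aut T, G x ->
    kappa (x^-1%g v0) = k -> G y /\ kappa (y^-1%g v0) = k.
  move=> k; have [[y Gy yk]|nk] :=
    pselect (exists2 y : aut T, G y & kappa (y^-1%g v0) = k); first by exists y.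
  by exists 1%g => x Gx xk; case: nk; exists x.
apply: (@sub_finite_set _ _ (\bigcup_(k in [set: K])
  [set left_coset (s * r k)%g H | s in vertex_stabilizer G v0])); last first.
  by apply: bigcup_finite => // k _; exact: finite_image.
move=> _ [x Gx <-]; exists (kappa (x^-1%g v0)) => //.
have [Gr /esym/kappaP[h Hh hx]] := rP _ x Gx erefl.
set y := r _ in Gr hx *.
exists (x * h^-1 * y^-1)%g; last first.
  by rewrite mulgVK left_cosetM //; exact: subgroupV.
split; last by rewrite !autM -hx !autK autVK.
by apply: subgroupM => //; [apply: subgroupM => // |]; apply: subgroupV => //; exact: HG.
Qed.

Theorem corollary1p6 (T : graph) (hT : locally_finite_biregular_tree T)
    (Gamma Gamma' : set (aut T))
    (hGamma : uniform_lattice Gamma) (hGamma' : uniform_lattice Gamma') :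
  exists g : aut T,
    finite_index (conjugate g Gamma `&` Gamma') (conjugate g Gamma) /\
    finite_index (conjugate g Gamma `&` Gamma') Gamma'.
Proof.
have [[connT acycT] [p [q [p_gt0 q_gt0 [c [adj_c degT]]]]]] := hT.
pose deg x := if c x then p else q.
have deg_c x y : c x = c y -> deg x = deg y by rewrite /deg => ->.
have deg_gt0 x : 0 < deg x by rewrite /deg; case: ifP.
have [[x0] _] := connT.
(* Colours alternate along edges, so keeping the colour of one vertex forces keeping all. *)
have colour_fixed (f : aut T) v : c (f v) = c v -> forall x, c (f x) = c x.
  move=> fv; apply: (connected_ind connT fv) => x y xy fx.
  have fxy : adj (f x) (f y) by rewrite aut_adj.
  move: (adj_c _ _ xy) (adj_c _ _ fxy); rewrite fx.
  by case: (c x); case: (c y); case: (c (f y)).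
have ports (G : set (aut T)) : uniform_lattice G ->
    exists (K : finType) (kappa : T -> K) (l : T -> T -> nat),
    port_numbering deg l /\
    forall v w, kappa v = kappa w -> exists f, [/\ G f /\ forall x, c (f x) = c x,
      f v = w & forall x y, l (f x) (f y) = l x y].
  move=> [sG Gfin /finite_setP[n /card_set_bijP[phi [phi_fun phi_inj _]]]].
  (* Vertices are classified by the number of their [G]-orbit and their colour, so an element of [G]
     joining two vertices of one class preserves colours. *)
  apply: (@invariant_port_numbering T c deg connT acycT adj_c degT
    [set f | G f /\ forall x, c (f x) = c x] _ _ _ _ _ _ _
    (fun v => (inord (phi (vertex_orbit G v)) : 'I_n.+1, c v))).
  - by split=> //; exact: subgroup1.
  - move=> f f' [Gf fc] [Gf' fc']; split; first exact: subgroupM.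
    by move=> x; rewrite autM fc.
  - move=> f [Gf fc]; split; first exact: subgroupV.
    by move=> x; rewrite -fc autVK.
  - by move=> f x [_ ->].
  - by move=> f x [_ fc]; exact: deg_c.
  - by move=> v; apply: sub_finite_set (Gfin v) => f [[]].
  move=> v w [/(congr1 val) /= + cvw].
  have phi_lt x : phi (vertex_orbit G x) < n.+1.
    by apply: leqW; apply: phi_fun; exists x.
  rewrite !inordK // => phivw.
  have orbvw : vertex_orbit G w = vertex_orbit G v.
    by apply: phi_inj; rewrite ?phivw //; apply: mem_set; [exists w | exists v].
  have : vertex_orbit G w w by exists 1%g => //; exact: subgroup1.
  rewrite orbvw => -[f Gf fv]; exists f => //; split=> //.
  by apply: (colour_fixed f v); rewrite fv -cvw.
have [K1 [kappa1 [l1 [l1P kappa1P]]]] := ports _ hGamma.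
have [K2 [kappa2 [l2 [l2P kappa2P]]]] := ports _ hGamma'.
have [g [k [k_lt gP]]] := glued_automorphism connT acycT adj_c deg_gt0 deg_c l1P l2P.
have [sG Gfin _] := hGamma; have [sG' Gfin' _] := hGamma'.
have sC := subgroup_conjugate g sG.
have sI := subgroupI sC sG'.
(* Here [v] is the second coordinate of the state over [g^-1 v]; both lattices and the reflection
   are recorded, with [p + q] bounding every valency. *)
pose kappa v : K1 * K2 * 'I_(p + q).+1 :=
  (kappa1 (g^-1%g v), kappa2 v, inord (k (g^-1%g v))).
have kappaP v w : kappa v = kappa w ->
    exists2 f, (conjugate g Gamma `&` Gamma') f & f v = w.
  move=> [/kappa1P[f [[Gf fc] fv fl]] /kappa2P[f' [[Gf' fc'] fv' fl']]].
  have k_ltS x : k x < (p + q).+1.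
    rewrite ltnS (leq_trans (ltnW (k_lt x))) // /deg.
    by case: ifP => _; [exact: leq_addr | exact: leq_addl].
  move=> /(congr1 val) /=; rewrite !inordK // => kvw.
  (* Intertwining says [f' = g f g^-1], which puts [f'] in both groups. *)
  have f'g := gP f f' _ _ fc fc' fl fl' fv.
  exists f' => //; split=> //; exists f => //; apply: aut_ext => x.
  by rewrite !autM -f'g ?autVK.
exists g; split.
  apply: (finite_index_cocompact (v0 := x0) sC sI _ _ kappaP); first exact: subIsetl.
  (* The stabilizer of [x0] in the conjugate comes from that of [g^-1 x0] in [Gamma]. *)
  apply: sub_finite_set (finite_image (fun f => g * f * g^-1)%g (Gfin (g^-1%g x0))).
  move=> _ [[f Gf <-] fx]; exists f => //; split=> //.
  by apply: (can_inj (autK g)); rewrite autVK.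
exact: (finite_index_cocompact (v0 := x0) sG' sI (@subIsetr _ _ _) (Gfin' x0) kappaP).
Qed.
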